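(* Let $p>3$ be a prime, $e\in\{3,4,6\}$ with $e\mid p+1$, $k\ge1$, and $\alpha\in\mathbb{P}^1(\mathbb{Q}_p)$ with $v(\alpha^{-1})\ge\max\{0,k-1\}$. Let $$g_k(x)=x^{p^{2k}}+\sum_{n=1}^k(-1)^np^n\big(x^{p^{2k-2n}}+\alpha^{-1}\pi_e^2x^{p^{2k+1-2n}}\big),\qquad g_k^\infty(x)=\sum_{n=0}^k(-1)^np^nx^{p^{2k-2n}}.$$ Then the splitting fields of $g_k$ and $g_k^\infty$ over $K$ coincide.
   Context: $v$ is the $p$-adic valuation with $v(p)=1$; $\pi_e\in\overline{\mathbb{Q}}_p$ is a fixed root of $x^e+p$, $\zeta_e$ a primitive $e$-th root of unity, $K=\mathbb{Q}_p(\pi_e,\zeta_e)$; convention $\alpha^{-1}=0$ if $\alpha=\infty$. *)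

(* Defs.v *)
From HB Require Import structures.
From mathcomp Require Import all_boot all_order all_algebra.
Set Implicit Arguments. Unset Strict Implicit. Unset Printing Implicit Defensive.
Import Order.TTheory GRing.Theory Num.Theory.
Local Open Scope ring_scope.

(* Setting: C plays the role of an algebraic closure of Q_p.  A valuation on
   C is a map v : C -> rat, meaningful on nonzero elements (v 0 = +oo by
   convention, encoded via [vge] below). *)

Definition is_valuation (C : fieldType) (v : C -> rat) : Prop :=
  (forall x y : C, x != 0 -> y != 0 -> v (x * y) = v x + v y) /\
  (forall x y : C, x != 0 -> y != 0 -> x + y != 0 ->
      Num.min (v x) (v y) <= v (x + y)).

(* "v x >= N", with the convention v 0 = +oo *)
Definition vge (C : fieldType) (v : C -> rat) (x : C) (N : rat) : Prop :=
  x = 0 \/ N <= v x.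

Definition is_subfield (C : fieldType) (F : C -> Prop) : Prop :=
  F 0 /\ F 1 /\
  (forall x y, F x -> F y -> F (x + y)) /\
  (forall x, F x -> F (- x)) /\
  (forall x y, F x -> F y -> F (x * y)) /\
  (forall x, F x -> F (x^-1)).

Definition gen_field (C : fieldType) (S : C -> Prop) : C -> Prop :=
  fun x => forall E : C -> Prop, is_subfield E -> (forall y, S y -> E y) -> E x.

Definition v_cauchy (C : fieldType) (v : C -> rat) (u : nat -> C) : Prop :=
  forall N : rat, exists M : nat, forall m n : nat, (M <= m)%N -> (M <= n)%N ->
    vge v (u m - u n) N.

Definition v_converges (C : fieldType) (v : C -> rat) (u : nat -> C) (l : C) : Prop :=
  forall N : rat, exists M : nat, forall n : nat, (M <= n)%N -> vge v (u n - l) N.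

(* F is (a copy of) Q_p inside C, with v the p-adic valuation (v(p) = 1):
   F is a subfield, complete for v, in which Q is v-dense. *)
Definition is_Qp (C : fieldType) (v : C -> rat) (F : C -> Prop) : Prop :=
  is_subfield F /\
  (forall u : nat -> C, (forall n, F (u n)) -> v_cauchy v u ->
      exists2 l, F l & v_converges v u l) /\
  (forall x, F x -> forall N : rat, exists q : rat, vge v (x - ratr q) N).

Definition algebraic_over (C : fieldType) (F : C -> Prop) : Prop :=
  forall x : C, exists P : {poly C},
    [/\ P != 0, forall i, F P`_i & root P x].

Definition g_poly (C : fieldType) (p k : nat) (ainv pi : C) : {poly C} :=
  'X^(p ^ (2 * k)) +
  \sum_(1 <= n < k.+1)
     ((-1) ^+ n * (p%:R) ^+ n) *:
       ('X^(p ^ (2 * k - 2 * n)) + (ainv * pi ^+ 2) *: 'X^(p ^ (2 * k + 1 - 2 * n))).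

Definition g_inf_poly (C : fieldType) (p k : nat) : {poly C} :=
  \sum_(0 <= n < k.+1) ((-1) ^+ n * (p%:R) ^+ n) *: 'X^(p ^ (2 * k - 2 * n)).

Definition splitting_field_over (C : fieldType) (K : C -> Prop) (P : {poly C})
  : C -> Prop :=
  gen_field (fun y => K y \/ root P y).

(* Main.v *)
(* Put b = ainv * pi ^+ 2, so that v b >= k - 2/3; the two polynomials are the
   members g_b and g_0 of one family.  All their roots are integral.  If
   v (w - u) = s >= 1/4 with u, w integral, raising to the p-th power (p >= 5)
   gains a full unit of valuation, so

     g_b(w) - g_b(u) = (-p)^k (w - u) + O(k + s + 1/3).

   Hence a value v (g_b(u)) >= k + 1/3 forces exactly one root x of g_b with
   v (x - u) >= 1/3, and a Newton iteration with constant slope (-p)^k produces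
   it inside any complete field containing u and b.  As g_b - g_b' is O(k + 1/3) on
   integral elements, the roots of g_b and g_b' are matched one to one, matched
   roots generating the same field over Q_p(pi).  Completeness of the finite
   extensions of Q_p is obtained by adjoining one power of a generator at a time. *)
Require Import Defs.
From HB Require Import structures.
From mathcomp Require Import all_boot all_order all_algebra.
From mathcomp Require Import ring lra zify.
From Stdlib Require Import Classical IndefiniteDescription.
Import Order.TTheory GRing.Theory Num.Theory.
Local Open Scope ring_scope.

(** * Subfields and the ultrametric calculus of [vge] *)

Lemma lt_bound_norm (N : rat) : N < (Num.bound `|N|)%:R.
Proof. by rewrite (le_lt_trans (ler_norm _)) // archi_boundP. Qed.

Lemma subfieldX {C : fieldType} {F : C -> Prop} x n : is_subfield F -> F x -> F (x ^+ n).
Proof.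
move=> [_ [F1 [_ [_ [FM _]]]]] Fx.
by elim: n => [|n IH] //; rewrite exprS; apply: (FM).
Qed.

Lemma subfield_nat {C : fieldType} {F : C -> Prop} n : is_subfield F -> F n%:R.
Proof.
move=> [F0 [F1 [FD _]]].
by elim: n => [|n IH] //; rewrite -natr1; apply: (FD).
Qed.

Section Valuation.
Context {C : fieldType} {v : C -> rat} (vP : is_valuation v).

Lemma valM x y : x != 0 -> y != 0 -> v (x * y) = v x + v y.
Proof. by case: vP => h _; exact: h. Qed.

Lemma val1 : v 1 = 0.
Proof. have := valM 1 1 (oner_neq0 _) (oner_neq0 _); rewrite mul1r; lra. Qed.

Lemma valN x : v (- x) = v x.
Proof.
have [->|x0] := eqVneq x 0; first by rewrite oppr0.
have n10 : (-1 : C) != 0 by rewrite oppr_eq0 oner_neq0.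
have := valM (-1) (-1) n10 n10; rewrite mulrNN mulr1 val1 => h.
rewrite -mulN1r valM //; lra.
Qed.

Lemma valV x : x != 0 -> v x^-1 = - v x.
Proof.
move=> x0; have := valM x x^-1 x0; rewrite invr_eq0 => /(_ x0).
rewrite mulfV // val1; lra.
Qed.

Lemma valX x n : x != 0 -> v (x ^+ n) = n%:R * v x.
Proof.
move=> x0; elim: n => [|n IH]; first by rewrite expr0 val1 mul0r.
by rewrite exprS valM ?expf_neq0 // IH -natr1 mulrDl mul1r addrC.
Qed.

Lemma vge_nz x N : x != 0 -> vge v x N -> N <= v x.
Proof. by move=> /eqP x0 []. Qed.

Lemma vge_le {x N} M : vge v x N -> M <= N -> vge v x M.
Proof. by case=> [->|h] le; [left|right; exact: le_trans h]. Qed.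

Lemma vgeD x y N : vge v x N -> vge v y N -> vge v (x + y) N.
Proof.
case: (eqVneq x 0) => [->|x0 hx hy]; first by rewrite add0r.
case: (eqVneq y 0) hy => [->|y0 hy]; first by rewrite addr0.
case: (eqVneq (x + y) 0) => [->|xy0]; first by left.
right; case: vP => _ /(_ x y x0 y0 xy0); apply: le_trans.
by rewrite le_min !vge_nz.
Qed.

Lemma vgeN x N : vge v x N -> vge v (- x) N.
Proof. by case=> [->|h]; [left; rewrite oppr0|right; rewrite valN]. Qed.

Lemma vgeB x y N : vge v x N -> vge v y N -> vge v (x - y) N.
Proof. by move=> hx hy; apply: vgeD => //; apply: vgeN. Qed.

Lemma vge_subC x y N : vge v (x - y) N -> vge v (y - x) N.
Proof. by move=> /vgeN; rewrite opprB. Qed.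

Lemma vge_sub_trans {x z N} y : vge v (x - y) N -> vge v (y - z) N -> vge v (x - z) N.
Proof. by move=> hx hy; rewrite -(subrK y x) -addrA; apply: vgeD. Qed.

Lemma vgeM x y N M : vge v x N -> vge v y M -> vge v (x * y) (N + M).
Proof.
case: (eqVneq x 0) => [->|x0 hx hy]; first by rewrite mul0r; left.
case: (eqVneq y 0) hy => [->|y0 hy]; first by rewrite mulr0; left.
by right; rewrite valM // lerD // vge_nz.
Qed.

Lemma vgeX x N n : vge v x N -> vge v (x ^+ n) (n%:R * N).
Proof.
move=> hx; elim: n => [|n IH]; first by right; rewrite expr0 val1 mul0r.
by rewrite exprS -natr1 mulrDl mul1r addrC; apply: vgeM.
Qed.

Lemma vge_int_expr x n : vge v x 0 -> vge v (x ^+ n) 0.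
Proof. by move=> /(vgeX _ _ n); rewrite mulr0. Qed.

Lemma vge_sum I (r : seq I) (P : pred I) F N :
  (forall i, P i -> vge v (F i) N) -> vge v (\sum_(i <- r | P i) F i) N.
Proof. by move=> h; apply: (big_ind (fun x => vge v x N)) => //; [left | move=> *; apply: vgeD]. Qed.

Lemma vge_nat n : vge v n%:R 0.
Proof.
elim: n => [|n IH]; first by left.
by rewrite -natr1; apply: vgeD => //; right; rewrite val1.
Qed.

Lemma vge_all_eq0 x : (forall n : nat, vge v x n%:R) -> x = 0.
Proof.
move=> h; apply/eqP; apply: contraT => x0.
by have := vge_nz _ _ x0 (h (Num.bound `|v x|)); rewrite leNgt lt_bound_norm.
Qed.

(** * Limits, and completeness of finite extensions *)

Lemma v_converges_uniq u l l' : v_converges v u l -> v_converges v u l' -> l = l'.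
Proof.
move=> hl hl'; apply/subr0_eq/vge_all_eq0 => n.
have [M hM] := hl n%:R; have [M' hM'] := hl' n%:R.
apply: (vge_sub_trans (u (maxn M M'))).
  by apply: vge_subC; apply: hM; rewrite leq_maxl.
by apply: hM'; rewrite leq_maxr.
Qed.

Lemma v_converges_cauchy u l : v_converges v u l -> v_cauchy v u.
Proof.
move=> h N; have [M hM] := h N; exists M => m n Mm Mn.
by apply: (vge_sub_trans l); [|apply: vge_subC]; apply: hM.
Qed.

(** Asked of an arbitrary subset, since the completeness argument passes through subspaces that need
    not be fields. *)
Definition v_complete (W : C -> Prop) : Prop :=
  forall u : nat -> C, (forall n, W (u n)) -> v_cauchy v u ->
    exists2 l, W l & v_converges v u l.

Definition is_subspace (F W : C -> Prop) : Prop :=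
  [/\ W 0, forall x y, W x -> W y -> W (x + y) & forall a x, F a -> W x -> W (a * x)].

Definition add_line (F W : C -> Prop) (w : C) : C -> Prop :=
  fun x => exists s a, [/\ W s, F a & x = s + a * w].

Lemma add_line_subspace {F W} w :
  is_subfield F -> is_subspace F W -> is_subspace F (add_line F W w).
Proof.
move=> [F0 [_ [FD [_ [FM _]]]]] [W0 WD WZ]; split.
- by exists 0, 0; split; rewrite ?mul0r ?addr0.
- move=> _ _ [s [a [Ws Fa ->]]] [t [b [Wt Fb ->]]].
  by exists (s + t), (a + b); split; [exact: WD | exact: FD | ring].
- move=> c _ Fc [s [a [Ws Fa ->]]].
  by exists (c * s), (c * a); split; [exact: WZ | exact: FM | ring].
Qed.

(** Without a bound, some sequence in [W] would converge to [w], and completeness would put [w] in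
    [W]. *)
Lemma complete_dist_bounded (W : C -> Prop) w : v_complete W -> ~ W w ->
  exists D : rat, forall s, W s -> v (w - s) <= D.
Proof.
move=> cW Ww; apply: NNPP => nD.
have h (n : nat) : exists s, W s /\ n%:R < v (w - s).
  apply: NNPP => hn; apply: nD; exists n%:R => s Ws.
  by rewrite leNgt; apply/negP => lt; apply: hn; exists s.
pose s n := sval (constructive_indefinite_description _ (h n)).
have [Ws ds] : (forall n, W (s n)) /\ forall n : nat, n%:R < v (w - s n).
  by split=> n; rewrite /s; case: constructive_indefinite_description => ? [].
have cs : v_converges v s w.
  move=> N; exists (Num.bound `|N|) => n Nn.
  apply: vge_subC; right; apply: ltW; apply: lt_trans (ds n).
  by apply: lt_le_trans (lt_bound_norm N) _; rewrite ler_nat.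
have [l Wl cl] := cW s Ws (v_converges_cauchy _ _ cs).
by apply: Ww; rewrite (v_converges_uniq _ _ _ cs cl).
Qed.

(* If [w] is outside the complete space [W] then it is at positive distance from
   it, so the coordinate along [w] is a bounded functional on [W + F w]. *)
Lemma add_line_complete {F W} w : is_subfield F -> v_complete F ->
  is_subspace F W -> v_complete W -> v_complete (add_line F W w).
Proof.
move=> [F0 [F1 [FD [FN [FM FV]]]]] cF [W0 WD WZ] cW u Wu cu.
have [Ww|nWw] := classic (W w).
  have Wu' n : W (u n).
    by have [s [a [Ws Fa ->]]] := Wu n; apply: WD => //; apply: WZ.
  have [l Wl cl] := cW u Wu' cu.
  by exists l => //; exists l, 0; split => //; rewrite mul0r addr0.
have WN x : W x -> W (- x) by rewrite -mulN1r; apply: WZ; apply: FN.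
have w0 : w != 0 by apply/eqP => e; apply: nWw; rewrite e.
have [D hD] := complete_dist_bounded _ _ cW nWw.
have h n : exists sa : C * C, [/\ W sa.1, F sa.2 & u n = sa.1 + sa.2 * w].
  by have [s [a ?]] := Wu n; exists (s, a).
pose sa n := sval (constructive_indefinite_description _ (h n)).
pose s n := (sa n).1; pose a n := (sa n).2.
have hsa n : [/\ W (s n), F (a n) & u n = s n + a n * w].
  by rewrite /s /a /sa; case: constructive_indefinite_description.
have Ws n : W (s n) by case: (hsa n).
have Fa n : F (a n) by case: (hsa n).
have ue n : u n = s n + a n * w by case: (hsa n).
have ca : v_cauchy v a.
  move=> N; have [M hM] := cu (N + D); exists M => m n Mm Mn.
  have [/eqP e|d0] := eqVneq (a m - a n) 0; first by left; apply/eqP.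
  (* Factoring out the coefficient of [w] makes [u m - u n] a multiple of [w - t] with [t] in [W];
     as [v (w - t) <= D], precision [N + D] for [u] gives precision [N] for [a]. *)
  pose t := (a m - a n)^-1 * (s n - s m).
  have Wt : W t.
    by apply: WZ; [apply/FV/FD/FN | apply/WD/WN].
  have wt0 : w - t != 0.
    by rewrite subr_eq0; apply/eqP => e; apply: nWw; rewrite e.
  have eu : u m - u n = (a m - a n) * (w - t).
    by rewrite mulrBr mulVKf // !ue; ring.
  have := hM _ _ Mm Mn; rewrite eu => /vge_nz.
  rewrite mulf_neq0 // valM // => /(_ isT) le; right.
  have := hD t Wt; lra.
have [a' Fa' ca'] := cF a Fa ca.
have cs : v_cauchy v s.
  move=> N; have [M hM] := cu N; have [M' hM'] := ca (N - v w).
  exists (maxn M M') => m n; rewrite !geq_max => /andP[Mm Mm'] /andP[Mn Mn'].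
  have -> : s m - s n = (u m - u n) - (a m - a n) * w by rewrite !ue; ring.
  apply: vgeB; first exact: hM.
  rewrite -(subrK (v w) N); apply: vgeM; first exact: hM'.
  by right.
have [s' Ws' cs'] := cW s Ws cs.
exists (s' + a' * w); first by exists s', a'.
move=> N; have [M hM] := cs' N; have [M' hM'] := ca' (N - v w).
exists (maxn M M') => n; rewrite geq_max => /andP[Mn Mn'].
have -> : u n - (s' + a' * w) = (s n - s') + (a n - a') * w by rewrite ue; ring.
apply: vgeD; first exact: hM.
rewrite -(subrK (v w) N); apply: vgeM; first exact: hM'.
by right.
Qed.

(** The [F]-span of the first [d] powers of [x], built line by line so that completeness follows by
    induction; the powers may be dependent. *)
Fixpoint pow_span (F : C -> Prop) (x : C) (d : nat) : C -> Prop :=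
  if d is d'.+1 then add_line F (pow_span F x d') (x ^+ d') else eq 0.

Section PowSpan.
Context {F : C -> Prop} (sF : is_subfield F) (x : C).

Lemma pow_span_subspace d : is_subspace F (pow_span F x d).
Proof.
elim: d => [|d IH]; last exact: add_line_subspace.
by split=> //= [_ _ <- <-|a _ _ <-]; rewrite ?addr0 ?mulr0.
Qed.

Lemma pow_span_complete d : v_complete F -> v_complete (pow_span F x d).
Proof.
move=> cF; elim: d => [|d IH] /=.
  by move=> u u0 _; exists 0 => // N; exists 0%N => n _; left; rewrite -u0 subr0.
by apply: add_line_complete => //; exact: pow_span_subspace.
Qed.

Lemma pow_spanS d y : pow_span F x d y -> pow_span F x d.+1 y.
Proof.
case: sF => F0 _ hy; exists y, 0; split => //.
by rewrite mul0r addr0.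
Qed.

Lemma pow_span_pow i d : (i < d)%N -> pow_span F x d (x ^+ i).
Proof.
elim: d => // d IH; rewrite ltnS leq_eqVlt => /orP[/eqP ->|/IH]; last exact: pow_spanS.
have [W0 _ _] := pow_span_subspace d.
by exists 0, 1; case: sF => _ [F1 _]; split => //; rewrite add0r mul1r.
Qed.

Lemma pow_span_mulX d y : pow_span F x d y -> pow_span F x d.+1 (x * y).
Proof.
elim: d y => [_ <-|d IH y [s [a [hs Fa ->]]]].
  by rewrite mulr0; case: (pow_span_subspace 1).
by exists (x * s), a; split => //; [exact: IH | rewrite exprS; ring].
Qed.

Lemma pow_span_min (E : C -> Prop) d y :
  is_subfield E -> (forall z, F z -> E z) -> E x -> pow_span F x d y -> E y.
Proof.
move=> sE FE Ex; have [E0 [E1 [ED [_ [EM _]]]]] := sE.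
elim: d y => [_ <- //|d IH _ [s [a [hs Fa ->]]]].
by apply: ED; [exact: IH | apply: EM; [exact: FE | exact: subfieldX]].
Qed.

(** With [d] the degree of [P], dividing by the leading coefficient expresses [x ^+ d] through lower
    powers. A nonzero constant has no root, hence [d > 0]. *)
Lemma pow_span_algebraic (P : {poly C}) :
  P != 0 -> (forall i, F P`_i) -> root P x ->
  exists2 d, (0 < d)%N & pow_span F x d (x ^+ d).
Proof.
move=> P0 FP /rootP rP; exists (size P).-1.
  case: (ltngtP (size P) 1) => [||s1]; rewrite ?ltnS ?leqn0 ?size_poly_eq0.
  - by rewrite (negPf P0).
  - by case: (size P).
  have c := size1_polyC (eq_leq s1); move: rP P0; rewrite c hornerC => ->.
  by rewrite polyC0 eqxx.
have lc0 : lead_coef P != 0 by rewrite lead_coef_eq0.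
move: rP lc0; rewrite horner_coef lead_coefE -(prednK (_ : 0 < size P)%N) ?lt0n ?size_poly_eq0 //=.
set d := (size P).-1 => rP lc0; rewrite big_ord_recr /= in rP.
have {rP} -> : x ^+ d = \sum_(i < d) (- (P`_d)^-1 * P`_i) * x ^+ i.
  apply: (mulfI lc0); rewrite mulr_sumr.
  under eq_bigr do rewrite mulrA mulrA mulrN mulfV // mulN1r mulNr.
  by rewrite sumrN; apply/eqP; rewrite -addr_eq0 addrC rP.
have [W0 WD WZ] := pow_span_subspace d.
elim/big_ind: _ => // i _; apply: WZ; last exact: pow_span_pow.
by case: sF => [_ [_ [_ [FN [FM FV]]]]]; apply: FM => //; apply/FN/FV/FP.
Qed.

End PowSpan.

(** Induction on the annihilating polynomial [Q * 'X + c]: if [c = 0] and [y != 0], then [Q] already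
    annihilates [y]; if [c != 0], then [y^-1 = - c^-1 * Q.[y]], which lies in [M]. *)
Lemma algebraic_subring_inv {F M : C -> Prop} :
  M 0 -> M 1 -> (forall y z, M y -> M z -> M (y + z)) ->
  (forall y z, M y -> M z -> M (y * z)) ->
  is_subfield F -> algebraic_over F -> (forall y, F y -> M y) ->
  forall y, M y -> M y^-1.
Proof.
move=> M0 M1 MD MM sF aF FM y My.
have [->|y0] := eqVneq y 0; first by rewrite invr0.
have [F0 [F1 [FD [FN [Fm FV]]]]] := sF.
have [P [P0 FP /rootP rP]] := aF y.
elim/poly_ind: P P0 FP rP => [|Q c IH] P0 FP rP; first by rewrite eqxx in P0.
have FQ i : F Q`_i by have := FP i.+1; rewrite coefD coefMX coefC /= addr0.
have Fc : F c by have := FP 0%N; rewrite coefD coefMX coefC /= add0r.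
rewrite !hornerE in rP.
have [c0|c0] := eqVneq c 0.
  apply: IH => //; first by apply: contra_neq P0 => ->; rewrite c0 mul0r add0r.
  by move: rP; rewrite c0 addr0 => /eqP; rewrite mulf_eq0 (negPf y0) orbF => /eqP.
have -> : y^-1 = (- c^-1) * Q.[y].
  apply: (mulIf y0); rewrite mulVf // -mulrA.
  have -> : Q.[y] * y = - c by apply/eqP; rewrite -addr_eq0 rP.
  by rewrite mulrNN mulVf.
apply: (MM); first by apply/FM/FN/FV.
rewrite horner_coef; apply: (big_ind M) => // i _.
apply: (MM); first exact: FM.
by elim: (i : nat) => [|j IHj] //; rewrite exprS; apply: MM.
Qed.

(** [M] is F(x), realised as a span of finitely many powers of [x]: a ring because [x ^+ d] reduces
    to lower powers, and a field by algebraicity. The last clause is its minimality. *)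
Lemma complete_adjoin {F : C -> Prop} (x : C) :
  is_subfield F -> v_complete F -> algebraic_over F ->
  exists M : C -> Prop,
    [/\ is_subfield M, v_complete M, forall y, F y -> M y, M x &
        forall E, is_subfield E -> (forall y, F y -> E y) -> E x -> forall y, M y -> E y].
Proof.
move=> sF cF aF; have [P [P0 FP rP]] := aF x.
have [d d0 hd] := pow_span_algebraic sF x P P0 FP rP.
have [W0 WD WZ] := pow_span_subspace sF x d.
pose M := pow_span F x d.
have M1 : M 1 by rewrite -(expr0 x); apply: pow_span_pow.
have FM y : F y -> M y by move=> Fy; rewrite -(mulr1 y); apply: WZ.
have Mx y : M y -> M (x * y).
  by move=> /(pow_span_mulX sF) [s [a [hs Fa ->]]]; apply: WD => //; apply: WZ.
have MX n y : M y -> M (x ^+ n * y).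
  by move=> My; elim: n => [|n IH]; rewrite ?mul1r // exprS -mulrA; apply: Mx.
have MM y z : M y -> M z -> M (y * z).
  (* The induction is on the length [j] of the span holding the left factor, while the target [M]
     keeps length [d]. *)
  rewrite {1}/M; elim: {1}d y => [_ <-|j IH _ [s [a [hs Fa ->]]]] Mz.
    by rewrite mul0r.
  by rewrite mulrDl -mulrA; apply: WD; [exact: IH | apply: WZ => //; exact: MX].
have [F0 [F1 [FD [FN [Fm FV]]]]] := sF.
have MN y : M y -> M (- y) by rewrite -mulN1r; apply: WZ; apply: FN.
have MV := algebraic_subring_inv W0 M1 WD MM sF aF FM.
exists M; split => //.
- exact: pow_span_complete.
- by rewrite -(mulr1 x); apply: Mx.
- by move=> E sE FE Ex y; apply: pow_span_min.
Qed.


(** * Fixed points of ultrametric contractions *)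

(** The [n]-th step of the iteration has valuation at least [r + n * eps]; by the ultrametric
    inequality the iterates are Cauchy and never leave the ball around [u0]. *)
Lemma contraction_fixpoint {M : C -> Prop} {T : C -> C} {u0 : C} (r eps : rat) :
  0 < eps -> v_complete M -> M u0 -> (forall u, M u -> M (T u)) ->
  vge v (T u0 - u0) r ->
  (forall u w s, vge v (u - u0) r -> vge v (w - u0) r -> r <= s ->
     vge v (u - w) s -> vge v (T u - T w) (s + eps)) ->
  exists x, [/\ M x, T x = x & vge v (x - u0) r].
Proof.
move=> eps0 cM Mu0 MT hu0 hT.
pose u n := iter n T u0.
have Mu n : M (u n) by elim: n => [|n IH] //; exact: MT.
have r_le n : r <= r + n%:R * eps by rewrite lerDl mulr_ge0 // ltW.
have hu n : vge v (u n - u0) r /\ vge v (u n.+1 - u n) (r + n%:R * eps).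
  elim: n => [|n [IH1 IH2]].
    by split; rewrite /= ?subrr ?mul0r ?addr0 //; left.
  have h1 : vge v (u n.+1 - u0) r.
    by apply: (vge_sub_trans (u n)) => //; apply: vge_le IH2 _.
  split=> //; rewrite -natr1 mulrDl mul1r addrA.
  exact: (hT (u n.+1) (u n)).
have hm n m : (n <= m)%N -> vge v (u m - u n) (r + n%:R * eps).
  move=> /subnK <-; elim: (m - n)%N => [|j IH]; first by rewrite subrr; left.
  apply: (vge_sub_trans (u (j + n)%N)) => //.
  apply: vge_le (proj2 (hu (j + n)%N)) _.
  by rewrite lerD2l ler_wpM2r ?ler_nat ?leq_addl // ltW.
have cu : v_cauchy v u.
  move=> N; exists (Num.bound `|(N - r) / eps|).
  set J := Num.bound _; have le : N <= r + J%:R * eps.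
    by rewrite -lerBlDl -ler_pdivrMr // ltW // lt_bound_norm.
  move=> m n Jm Jn; apply: (vge_sub_trans (u J)).
    by apply: vge_le le; exact: hm.
  by apply: vge_subC; apply: vge_le le; exact: hm.
have [x Mx cx] := cM u Mu cu.
have xu0 : vge v (x - u0) r.
  have [J /(_ J (leqnn _)) h] := cx r.
  by apply: (vge_sub_trans (u J)); [exact: vge_subC | case: (hu J)].
exists x; split=> //; apply/subr0_eq/vge_all_eq0 => j.
(* The contraction estimate is available only for [s >= r], so the target precision [j] is raised to
   at least [r]. *)
pose s := Num.max r j%:R.
have [rs js] : r <= s /\ j%:R <= s by rewrite /s !le_max !lexx orbT.
have [J h] := cx s.
have hJ := h J (leqnn _); have hJ1 := h J.+1 (leqnSn _).
apply: (vge_sub_trans (u J.+1)); last exact: vge_le hJ1 js.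
have := hT x (u J) s xu0 (proj1 (hu J)) rs (vge_subC _ _ _ hJ).
by move=> /vge_le; apply; apply: le_trans js _; rewrite lerDl ltW.
Qed.

(** * Differences of powers, and the gain from raising to the [p]-th power *)

Lemma vge_diff_exp u w s n : vge v u 0 -> vge v w 0 ->
  vge v (w - u) s -> vge v (w ^+ n - u ^+ n) s.
Proof.
move=> u0 w0 h; rewrite subrXX -[s]addr0; apply: vgeM => //.
by apply: vge_sum => i _; rewrite -[0]addr0; apply: vgeM; apply: vge_int_expr.
Qed.

Section PAdic.
Context {p : nat} (p_pr : prime p) (p_gt3 : (3 < p)%N) (vp : v p%:R = 1).

Lemma vge_p n : vge v ((-1) ^+ n * p%:R ^+ n) n%:R.
Proof.
rewrite -[n%:R]add0r; apply: vgeM; last first.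
  by rewrite -[n%:R]mulr1; apply: vgeX; right; rewrite vp.
by apply: vge_int_expr; right; rewrite valN val1.
Qed.

(** Expand the [p]-th power of [z + u], where [z = w - u]. The middle binomial coefficients are
    divisible by [p], and [z ^+ p] has valuation at least [p * s >= s + 1] because [p >= 5] and
    [s >= 1 / 4]. *)
Lemma vge_diff_exp_prime u w s : 1 / 4 <= s -> vge v u 0 ->
  vge v (w - u) s -> vge v (w ^+ p - u ^+ p) (s + 1).
Proof.
move=> s4 u0; move: (w - u) (subrK u w) => z <- hz {w}.
have p4 : (4 < p)%N by move: p_pr p_gt3; case: (ltngtP p 4) => // ->.
have z0 : vge v z 0 by apply: vge_le hz _; lra.
rewrite [z + u]addrC exprDn big_ord_recl /= subn0 expr0 mulr1 bin0 mulr1n addrC addKr.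
apply: vge_sum => i _; rewrite /bump /= add1n -mulr_natr.
have hi := ltn_ord i.
case: (ltnP i.+1 p) => ip.
  rewrite -[s]add0r; apply: vgeM; last first.
    have /dvdnP [m ->] : (p %| 'C(p, i.+1))%N by exact: prime_dvd_bin.
    rewrite natrM -[1 : rat]add0r; apply: vgeM; first exact: vge_nat.
    by right; rewrite vp.
  apply: vgeM; first exact: vge_int_expr.
  by rewrite exprS -[s]addr0; apply: vgeM => //; exact: vge_int_expr.
have -> : i.+1 = p by apply/eqP; rewrite eqn_leq hi ip.
rewrite subnn expr0 mul1r binn mulr1.
apply: vge_le (vgeX _ _ p hz) _.
have : (5%:R : rat) <= p%:R by rewrite ler_nat.
by nra.
Qed.

Lemma vge_diff_exp_ppow u w s n : 1 / 4 <= s -> vge v u 0 -> vge v w 0 ->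
  vge v (w - u) s -> vge v (w ^+ (p ^ n) - u ^+ (p ^ n)) (s + n%:R).
Proof.
move=> s4 u0 w0 h; elim: n => [|n IH]; first by rewrite !expn0 !expr1 addr0.
rewrite expnSr !exprM -natr1 addrA; apply: vge_diff_exp_prime => //.
  by have : 0 <= n%:R :> rat by []; lra.
exact: vge_int_expr.
Qed.

(** * The family g_b: linear approximation and location of roots *)

Context {k : nat} (k_gt0 : (0 < k)%N).

(* The value at [u] of [g_poly], with [b] standing for [ainv * pi ^+ 2]. *)
Definition g_val (b u : C) : C :=
  u ^+ (p ^ (2 * k)) +
  \sum_(1 <= n < k.+1) ((-1) ^+ n * p%:R ^+ n) *
     (u ^+ (p ^ (2 * k - 2 * n)) + b * u ^+ (p ^ (2 * k + 1 - 2 * n))).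

Lemma horner_g_poly a pi u : (g_poly p k a pi).[u] = g_val (a * pi ^+ 2) u.
Proof.
rewrite /g_poly /g_val hornerD hornerXn horner_sum; congr (_ + _).
by apply: eq_bigr => n _; rewrite hornerZ hornerD hornerZ !hornerXn.
Qed.

Lemma g_val_closed {M : C -> Prop} {b u} : is_subfield M -> M b -> M u -> M (g_val b u).
Proof.
move=> sM Mb Mu; have [M0 [M1 [MD [MN [MM _]]]]] := sM.
apply: (MD); first exact: subfieldX.
apply: (big_ind M) => // n _; apply: (MM).
  by apply: (MM); apply: subfieldX => //; [exact: MN | exact: subfield_nat].
by apply: (MD); [|apply: (MM) => //]; apply: subfieldX.
Qed.

(** Only the terms containing the parameter differ; each carries [p ^ n] with [n >= 1], which lifts
    [k - 2 / 3] to at least [k + 1 / 3]. *)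
Lemma g_val_diff_param b b' u : vge v u 0 ->
  vge v b (k%:R - 2 / 3) -> vge v b' (k%:R - 2 / 3) ->
  vge v (g_val b u - g_val b' u) (k%:R + 1 / 3).
Proof.
move=> u0 hb hb'; rewrite /g_val opprD addrACA subrr add0r -sumrB big_nat_cond.
apply: vge_sum => n; rewrite andbT => /andP[n1 _].
rewrite -mulrBr opprD addrACA subrr add0r -mulrBl mulrA.
rewrite -[_ + 1 / 3]addr0; apply: vgeM; last exact: vge_int_expr.
apply: (vge_le (N := n%:R + (k%:R - 2 / 3))).
  by apply: vgeM; [exact: vge_p | exact: vgeB].
have : 1 <= n%:R :> rat by rewrite ler1n.
lra.
Qed.

(** The [n]-th difference of powers without [b] has valuation at least
    [n + s + (2 * k - 2 * n) = s + 2 * k - n], hence at least [s + k + 1] for [n < k]. The term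
    [n = k] has exponent [p ^ 0 = 1] and is exactly linear. Terms with [b] reach
    [n + (k - 2 / 3) + s] with [n >= 1]. *)
Lemma g_val_near_linear b u w s : 1 / 4 <= s -> vge v u 0 -> vge v w 0 ->
  vge v b (k%:R - 2 / 3) -> vge v (w - u) s ->
  vge v (g_val b w - g_val b u - (-1) ^+ k * p%:R ^+ k * (w - u)) (k%:R + s + 1 / 3).
Proof.
move=> s4 u0 w0 hb h.
have k1 : 1 <= k%:R :> rat by rewrite ler1n.
have perturb n m : (0 < n)%N ->
    vge v ((-1) ^+ n * p%:R ^+ n * (b * (w ^+ m - u ^+ m))) (k%:R + s + 1 / 3).
  move=> n0; apply: (vge_le (N := n%:R + ((k%:R - 2 / 3) + s))).
    apply: vgeM; first exact: vge_p.
    by apply: vgeM => //; exact: vge_diff_exp.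
  have : 1 <= n%:R :> rat by rewrite ler1n.
  lra.
have -> : g_val b w - g_val b u - (-1) ^+ k * p%:R ^+ k * (w - u) =
    (w ^+ (p ^ (2 * k)) - u ^+ (p ^ (2 * k))) +
    \sum_(1 <= n < k) ((-1) ^+ n * p%:R ^+ n) *
       ((w ^+ (p ^ (2 * k - 2 * n)) - u ^+ (p ^ (2 * k - 2 * n)))
        + b * (w ^+ (p ^ (2 * k + 1 - 2 * n)) - u ^+ (p ^ (2 * k + 1 - 2 * n)))) +
    (-1) ^+ k * p%:R ^+ k *
      (b * (w ^+ (p ^ (2 * k + 1 - 2 * k)) - u ^+ (p ^ (2 * k + 1 - 2 * k)))).
  rewrite /g_val !big_nat_recr //= !subnn !expn0 !expr1.
  under [X in _ = _ + X + _]eq_bigr do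
    rewrite mulrBr addrACA -opprD mulrBr.
  rewrite sumrB.
  set S := \sum_(_ <= _ < _) _; set S' := \sum_(_ <= _ < _) _.
  set c := _ ^+ k * _.
  ring.
apply: vgeD; last exact: perturb.
apply: vgeD.
  apply: vge_le (vge_diff_exp_ppow _ _ _ _ s4 u0 w0 h) _.
  by rewrite natrM; lra.
rewrite big_nat_cond; apply: vge_sum => n; rewrite andbT => /andP[n1 nk].
rewrite mulrDr; apply: vgeD; last exact: perturb.
apply: vge_le (vgeM _ _ _ _ (vge_p n) (vge_diff_exp_ppow _ _ _ _ s4 u0 w0 h)) _.
rewrite natrB ?leq_mul2l 1?ltnW // !natrM.
have : n.+1%:R <= k%:R :> rat by rewrite ler_nat.
rewrite -natr1; lra.
Qed.

(** If [v u < 0], the leading power has valuation [N * v u], strictly below that of every other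
    term: these have integral coefficients and exponents at most [N - 1]. *)
Lemma g_val_root_integral b u : vge v b (k%:R - 2 / 3) -> g_val b u = 0 -> vge v u 0.
Proof.
move=> hb r0; have [->|u0] := eqVneq u 0; first by left.
right; rewrite leNgt; apply/negP => vu.
have k1 : 1 <= k%:R :> rat by rewrite ler1n.
pose N := (p ^ (2 * k))%N.
have p1 := prime_gt1 p_pr; have N0 : (0 < N)%N by rewrite expn_gt0 ltnW.
have hpow m : (m < 2 * k)%N -> vge v (u ^+ (p ^ m)) (N.-1%:R * v u).
  move=> mk; right; rewrite valX // ler_wnM2r ?(ltW vu) // ler_nat -ltnS prednK //.
  by rewrite ltn_exp2l.
have b0 : vge v b 0 by apply: vge_le hb _; lra.
have h : vge v (u ^+ N) (N.-1%:R * v u).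
  have -> : u ^+ N = - \sum_(1 <= n < k.+1) ((-1) ^+ n * p%:R ^+ n) *
     (u ^+ (p ^ (2 * k - 2 * n)) + b * u ^+ (p ^ (2 * k + 1 - 2 * n))).
    by apply/eqP; rewrite -addr_eq0 -/(g_val b u) r0.
  apply: vgeN; rewrite big_nat_cond; apply: vge_sum => n; rewrite andbT => /andP[n1 nk].
  rewrite -[_ * v u]add0r; apply: vgeM; first by apply: vge_le (vge_p n) _.
  apply: vgeD; first by apply: hpow; lia.
  by rewrite -[_ * v u]add0r; apply: vgeM => //; apply: hpow; lia.
have := vge_nz _ _ (expf_neq0 N u0) h.
rewrite valX // -{2}(prednK N0) -natr1; lra.
Qed.

Context (p0 : p%:R != 0 :> C).

Lemma g_lin_neq0 : (-1) ^+ k * p%:R ^+ k != 0 :> C.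
Proof. by rewrite mulf_neq0 ?expf_neq0 // oppr_eq0 oner_neq0. Qed.

Lemma val_g_lin : v ((-1) ^+ k * p%:R ^+ k) = k%:R.
Proof.
rewrite valM ?expf_neq0 ?oppr_eq0 ?oner_neq0 //.
by rewrite !valX ?oppr_eq0 ?oner_neq0 // valN val1 vp mulr0 add0r mulr1.
Qed.

(** For distinct roots at distance [s = v (w - u)], the linear term has valuation exactly [k + s],
    while the approximation forces at least [k + s + 1 / 3]. *)
Lemma g_val_root_uniq b u w : vge v b (k%:R - 2 / 3) ->
  g_val b u = 0 -> g_val b w = 0 -> vge v (w - u) (1 / 3) -> w = u.
Proof.
move=> hb ru rw h; apply/subr0_eq; apply: NNPP => /eqP d0.
have u0 := g_val_root_integral _ _ hb ru; have w0 := g_val_root_integral _ _ hb rw.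
have s3 := vge_nz _ _ d0 h.
have := g_val_near_linear b u w (v (w - u)) _ u0 w0 hb (or_intror (lexx _)).
rewrite ru rw subrr sub0r => /(_ _)/vgeN; rewrite opprK => hh.
have {hh} := vge_nz _ _ _ (hh _); rewrite mulf_neq0 ?g_lin_neq0 // valM ?g_lin_neq0 //.
rewrite val_g_lin => /(_ isT) hh; have : 1 / 4 <= v (w - u) by lra.
move=> /hh; lra.
Qed.

(* Newton's iteration with the fixed slope [(-p) ^ k]. *)
Lemma g_val_root_near {M : C -> Prop} {b u} : is_subfield M -> v_complete M ->
  M b -> M u -> vge v b (k%:R - 2 / 3) -> vge v u 0 ->
  vge v (g_val b u) (k%:R + 1 / 3) ->
  exists x, [/\ M x, g_val b x = 0 & vge v (x - u) (1 / 3)].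
Proof.
move=> sM cM Mb Mu hb u0 hgu.
have [_ [M1 [MD [MN [MM MV]]]]] := sM.
pose c : C := (-1) ^+ k * p%:R ^+ k.
have c0 : c != 0 := g_lin_neq0.
have vc : vge v c^-1 (- k%:R) by right; rewrite valV // val_g_lin.
have Mc : M c.
  by apply: (MM); apply: subfieldX => //; [exact: MN | exact: subfield_nat].
pose T w := w - c^-1 * g_val b w.
have MT w : M w -> M (T w).
  by move=> Mw; apply: (MD) => //; apply/MN/MM; [apply: MV | exact: g_val_closed].
have hTu : vge v (T u - u) (1 / 3).
  rewrite /T addrC addKr; apply: vgeN.
  by apply: vge_le (vgeM _ _ _ _ vc hgu) _; lra.
have intg w : vge v (w - u) (1 / 3) -> vge v w 0.
  by move=> h; rewrite -(subrK u w); apply: vgeD => //; apply: vge_le h _.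
have hT w z s : vge v (w - u) (1 / 3) -> vge v (z - u) (1 / 3) -> 1 / 3 <= s ->
    vge v (w - z) s -> vge v (T w - T z) (s + 1 / 3).
  move=> /intg w0 /intg z0 s3 h.
  (* The linear parts cancel and leave the approximation error; dividing it by [c] costs [k], so a
     gain of [1 / 3] remains. *)
  have -> : T w - T z = - (c^-1 * (g_val b w - g_val b z - c * (w - z))).
    by rewrite /T; field.
  apply: vgeN; have s4 : 1 / 4 <= s by lra.
  by apply: vge_le (vgeM _ _ _ _ vc (g_val_near_linear _ _ _ _ s4 z0 w0 hb h)) _; lra.
have [x [Mx Tx xu]] := contraction_fixpoint (1 / 3) (1 / 3) isT cM Mu MT hTu hT.
exists x; split => //; apply: (mulfI (invr_neq0 c0)); rewrite mulr0.
by apply/eqP; rewrite -oppr_eq0; apply/eqP; rewrite -[RHS](subrr x) -{2}Tx /T addrC addKr.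
Qed.

(* A root [y] for the parameter [b] is first moved to a nearby root [x] for
   [b'], and from there back to a root for [b] inside the field of [x];
   uniqueness of nearby roots identifies the latter with [y]. *)
Lemma g_val_roots_transfer {F E : C -> Prop} {b b'} :
  is_subfield F -> v_complete F -> algebraic_over F -> F b -> F b' ->
  vge v b (k%:R - 2 / 3) -> vge v b' (k%:R - 2 / 3) ->
  is_subfield E -> (forall x, F x -> E x) -> (forall x, g_val b' x = 0 -> E x) ->
  forall y, g_val b y = 0 -> E y.
Proof.
move=> sF cF aF Fb Fb' hb hb' sE FE rE y ry.
have y0 := g_val_root_integral _ _ hb ry.
(* F(y) serves only as a complete field in which to find [x]. The later field [M'], F(x), must lie
   in [E], so minimality is kept there. *)
have [M [sM cM FM My _]] := complete_adjoin y sF cF aF.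
have hy : vge v (g_val b' y) (k%:R + 1 / 3).
  by rewrite -(subr0 (g_val b' y)) -ry; exact: g_val_diff_param.
have [x [_ rx xy]] := g_val_root_near sM cM (FM _ Fb') My hb' y0 hy.
have x0 := g_val_root_integral _ _ hb' rx.
have [M' [sM' cM' FM' Mx minM']] := complete_adjoin x sF cF aF.
have hx : vge v (g_val b x) (k%:R + 1 / 3).
  by rewrite -(subr0 (g_val b x)) -rx; exact: g_val_diff_param.
have [z [Mz rz zx]] := g_val_root_near sM' cM' (FM' _ Fb) Mx hb x0 hx.
have <- : z = y.
  by apply: (g_val_root_uniq _ _ _ hb) => //; exact: vge_sub_trans zx xy.
by apply: minM' => //; exact: rE.
Qed.

End PAdic.
End Valuation.

(** * Passage to the splitting fields *)

(** The case of infinite alpha: the [n = 0] summand is the leading monomial, so both polynomials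
    belong to one family. *)
Lemma g_inf_poly_param0 (C : fieldType) (p k : nat) (pi : C) :
  g_inf_poly C p k = g_poly p k 0 pi.
Proof.
rewrite /g_inf_poly /g_poly big_ltn // muln0 subn0 mulr1 scale1r; congr (_ + _).
by apply: eq_bigr => n _; rewrite mul0r scale0r addr0.
Qed.

(** Since [v pi = 1 / e >= 1 / 6], the factor [pi ^+ 2] adds at least [1 / 3] to [k - 1]. *)
Lemma vge_param {C : fieldType} {v : C -> rat} {p e k : nat} {a pi : C} :
  is_valuation v -> v p%:R = 1 -> p%:R != 0 :> C ->
  (0 < e)%N -> (e <= 6)%N -> pi ^+ e + p%:R = 0 ->
  vge v a (Num.max 0 (k%:Q - 1)) -> vge v (a * pi ^+ 2) (k%:R - 2 / 3).
Proof.
move=> vP vp p0 e0 e6 epi ha.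
have pie : pi ^+ e = - p%:R by apply/eqP; rewrite -addr_eq0 epi.
have pi0 : pi != 0.
  by apply: contra_neq p0 => z; apply: oppr_inj; rewrite -pie z expr0n gtn_eqF ?oppr0.
have := valX vP pi e pi0; rewrite pie valN // vp => ve.
have v6 : 1 / 6 <= v pi.
  have h1 : 1 <= e%:R :> rat by rewrite ler1n.
  have h6 : e%:R <= 6%:R :> rat by rewrite ler_nat.
  nra.
have ha' : vge v a (k%:R - 1) by apply: vge_le ha _; rewrite le_max lexx orbT.
have -> : k%:R - 2 / 3 = (k%:R - 1) + 2 * (1 / 6) :> rat by field.
by apply: vgeM => //; apply: vgeX => //; right.
Qed.

(** One inclusion, with hypotheses symmetric in [a] and [b], so that exchanging them gives the
    other. *)
Lemma splitting_field_g_sub {C : fieldType} {v : C -> rat} {Qp K : C -> Prop}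
    {p e k : nat} {a b pi : C} :
  is_valuation v -> v p%:R = 1 -> p%:R != 0 :> C ->
  is_Qp v Qp -> algebraic_over Qp -> prime p -> (3 < p)%N ->
  (0 < e)%N -> (e <= 6)%N -> (0 < k)%N -> pi ^+ e + p%:R = 0 ->
  (forall x, Qp x -> K x) -> K pi -> Qp a -> Qp b ->
  vge v a (Num.max 0 (k%:Q - 1)) -> vge v b (Num.max 0 (k%:Q - 1)) ->
  forall x, splitting_field_over K (g_poly p k a pi) x ->
    splitting_field_over K (g_poly p k b pi) x.
Proof.
move=> vP vp p0 [sQ [cQ _]] aQ p_pr p_gt3 e0 e6 k0 epi QK Kpi Qa Qb ha hb x hx E sE hE.
have KE y : K y -> E y by move=> Ky; apply: hE; left.
(* The base field is Qp(pi): complete, containing both parameters [a * pi ^+ 2] and [b * pi ^+ 2],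
   and contained in [K]. *)
have [F [sF cF QF Fpi minF]] := complete_adjoin vP pi sQ cQ aQ.
have aF : algebraic_over F.
  by move=> y; have [P [P0 QP rP]] := aQ y; exists P; split=> // i; exact: QF.
have FE y : F y -> E y.
  by apply: minF => // [z Qz|]; apply: KE => //; exact: QK.
have Fb c : Qp c -> F (c * pi ^+ 2).
  case: sF => _ [_ [_ [_ [FM _]]]] Qc.
  by apply: (FM); [exact: QF | rewrite expr2; apply: (FM)].
apply: hx => // y [|]; first exact: KE.
move=> /rootP; rewrite horner_g_poly; move: y.
apply: (g_val_roots_transfer vP p_pr p_gt3 vp k0 p0 sF cF aF (Fb _ Qa) (Fb _ Qb)) => //.
- exact: (vge_param vP vp p0 e0 e6 epi).
- exact: (vge_param vP vp p0 e0 e6 epi).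
- by move=> y ry; apply: hE; right; apply/rootP; rewrite horner_g_poly.
Qed.

Theorem mainTheorem18
  (C : closedFieldType) (v : C -> rat) (Qp : C -> Prop)
  (p e k : nat) (ainv pi zeta : C) :
  [pchar C] =i pred0 ->
  is_valuation v -> v (p%:R) = 1 ->
  is_Qp v Qp -> algebraic_over Qp ->
  prime p -> (3 < p)%N ->
  e \in [:: 3; 4; 6]%N -> (e %| p.+1)%N ->
  (1 <= k)%N ->
  Qp ainv -> vge v ainv (Num.max 0 (k%:Q - 1)) ->
  pi ^+ e + p%:R = 0 ->
  e.-primitive_root zeta ->
  let K := gen_field (fun y => Qp y \/ y = pi \/ y = zeta) in
  forall x : C,
    splitting_field_over K (g_poly p k ainv pi) x <->
    splitting_field_over K (g_inf_poly C p k) x.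
Proof.
move=> pc0 vP vp hQ aQ p_pr p_gt3 he _ k0 Qa ha epi _ K x.
(* As [v 0] is an arbitrary rational, [v p%:R = 1] does not exclude [p%:R = 0]; characteristic zero
   does. *)
have p0 : p%:R != 0 :> C.
  by apply/negP => h; have := pc0 p; rewrite inE p_pr h.
have [e0 e6] : (0 < e)%N /\ (e <= 6)%N.
  by move: he; rewrite !inE => /or3P[] /eqP ->.
have QK y : Qp y -> K y by move=> Qy E _; apply; left.
have Kpi : K pi by move=> E _; apply; right; left.
have Q0 : Qp 0 by case: hQ => -[].
have v0 : vge v 0 (Num.max 0 (k%:Q - 1)) by left.
rewrite (g_inf_poly_param0 _ _ _ pi).
by split; exact: (splitting_field_g_sub vP vp p0 hQ aQ p_pr p_gt3 e0 e6 k0 epi QK Kpi).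
Qed.
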